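(* Let $\mathbb{F}$ and $\mathbb{K}$ be fields of characteristics different from $2$, and let $n\ge 2$ and $k\ge 1$. There exists a nonconstant Jordan multiplicative map $M_n(\mathbb{F})^+\to M_k(\mathbb{K})^+$ if and only if $k\ge n\,d_{\mathbb{K}}(\mathbb{F})$, where the inequality is understood to be false when $d_{\mathbb{K}}(\mathbb{F})=\infty$. Equivalently, if $k<n\,d_{\mathbb{K}}(\mathbb{F})$, then every Jordan multiplicative map $M_n(\mathbb{F})^+\to M_k(\mathbb{K})^+$ is constant with idempotent value.
   Context: For fields $\mathbb{F}$ and $\mathbb{K}$, $d_{\mathbb{K}}(\mathbb{F})$ is the least integer $r\ge 1$ for which there exists a unital ring homomorphism $\mathbb{F}\to M_r(\mathbb{K})$; if no such $r$ exists, $d_{\mathbb{K}}(\mathbb{F})=\infty$. For a field $\mathbb{L}$ of characteristic different from $2$, $M_m(\mathbb{L})^+$ denotes the set of $m\times m$ matrices over $\mathbb{L}$ with the product $X\circ Y:=\frac12(XY+YX)$. A map $\phi:M_n(\mathbb{F})^+\to M_k(\mathbb{K})^+$ is Jordan multiplicative if $\phi(X\circ Y)=\phi(X)\circ\phi(Y)$ for all $X,Y$ (no additivity is assumed). *)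

(* Defs.v *)
From mathcomp Require Import all_boot all_order all_algebra.
From mathcomp Require Import boolp.

Set Implicit Arguments.
Unset Strict Implicit.
Unset Printing Implicit Defensive.

Import GRing.Theory.
Local Open Scope ring_scope.

(* {rmorphism _ -> _} includes the preservation of 1. The guard 0 < r matters:
   'M[K]_0 is the zero ring, into which every field has a unital morphism. *)
Definition matrix_embeddable (K F : fieldType) (r : nat) : Prop :=
  (0 < r)%N /\ inhabited {rmorphism F -> 'M[K]_r}.

(* d_K(F), with None standing for infinity. *)
Definition matrix_degree (K F : fieldType) : option nat :=
  match pselect (exists r, `[< matrix_embeddable K F r >]) with
  | left h => Some (ex_minn h)
  | right _ => None
  end.

Lemma matrix_degree_SomeP (K F : fieldType) (r : nat) :
  matrix_degree K F = Some r <->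
  matrix_embeddable K F r /\
  (forall s, matrix_embeddable K F s -> (r <= s)%N).
Proof.
rewrite /matrix_degree; case: pselect => [h|nh]; last first.
  by split=> // -[hr _]; case: nh; exists r; apply/asboolP.
case: ex_minnP => m /asboolP hm min; split=> [[<-]|[hr minr]].
  by split=> // s hs; apply/min/asboolP.
congr Some; apply/eqP; rewrite eqn_leq minr // andbT.
exact/min/asboolP.
Qed.

Lemma matrix_degree_NoneP (K F : fieldType) :
  matrix_degree K F = None <-> forall r, ~ matrix_embeddable K F r.
Proof.
rewrite /matrix_degree; case: pselect => [h|nh]; split=> //.
  by move=> nemb; have [r /asboolP /nemb] := h.
by move=> _ r hr; apply: nh; exists r; apply/asboolP.
Qed.

(* n * d <= k and k < n * d in the extended naturals, for n > 0. *)
Definition muln_ext_leq (n : nat) (d : option nat) (k : nat) : bool :=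
  if d is Some r then (n * r <= k)%N else false.

Definition ltn_muln_ext (k n : nat) (d : option nat) : bool :=
  if d is Some r then (k < n * r)%N else true.

Definition jordan_mul (L : fieldType) (m : nat) (X Y : 'M[L]_m) : 'M[L]_m :=
  2%:R^-1 *: (X *m Y + Y *m X).

Definition jordan_multiplicative (F K : fieldType) (n k : nat)
    (phi : 'M[F]_n -> 'M[K]_k) : Prop :=
  forall X Y, phi (jordan_mul X Y) = jordan_mul (phi X) (phi Y).

Definition nonconstant (A B : Type) (f : A -> B) : Prop :=
  exists x y, f x <> f y.

(* Main.v *)
(* Subtracting phi 0, one may assume phi 0 = 0. Let e_i be the image of E_ii; the
   e_i are orthogonal idempotents. On the corner of M_n(F) spanned by E_ii, E_ij,
   E_ji, E_jj, with i != j, the image s of the involution E_ij + E_ji satisfies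
   s ^+ 2 = e_i + e_j and e_i = s e_j s, so all e_i have the same rank r and
   n r <= k; moreover r > 0, since e_0 = 0 forces phi = 0. Writing c a for the
   image of a (E_ii + E_jj), the Jordan products diag(a, b) o (E_ij + E_ji) make
   c additive. If x and y are the images of E_ij and E_ji, then xy + yx = e_i + e_j
   and c a c b xy + c b c a yx = c (ab): c is multiplicative on the part xy and
   antimultiplicative on the part yx, hence multiplicative because F is
   commutative. Cutting c down by e_i gives a unital morphism F -> M_r(K).
   Conversely, a unital morphism F -> M_r(K) applied entrywise embeds M_n(F) in
   M_(nr)(K), and hence, after padding with zeros, in M_k(K). *)

Require Import Defs.
From HB Require Import structures.
From mathcomp Require Import all_boot all_order all_algebra.
From mathcomp Require Import ring.

Set Implicit Arguments.
Unset Strict Implicit.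
Unset Printing Implicit Defensive.

Import GRing.Theory.
Local Open Scope ring_scope.

(** * Idempotents, Peirce components and Jordan products *)

Lemma idem_jordan_fix (A : pzRingType) (e x : A) :
    injective (fun a : A => a *+ 2) -> e * e = e ->
  e * x + x * e = x *+ 2 -> e * x = x /\ x * e = x.
Proof.
move=> tf ee exx.
have l : e * x * e = e * x.
  have := congr1 ( *%R e) exx.
  by rewrite mulrDr !mulrA ee mulrnAr mulr2n => /addrI.
have r : e * x * e = x * e.
  have := congr1 ( *%R^~ e) exx.
  by rewrite mulrDl -(mulrA x) ee mulrnAl mulr2n => /addIr.
have exe : e * x = x * e by rewrite -l r.
suff E : e * x = x by rewrite -exe.
by apply: tf; rewrite /= -exx -exe mulr2n.
Qed.

(** Multiplying the hypothesis by [e] on either side gives [e x + e x e = 2 z = e x e + x e], so [x]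
    commutes with [e]. The case [z = 0] yields orthogonality. *)
Lemma idem_jordan_corner (A : pzRingType) (e x z : A) :
    injective (fun a : A => a *+ 2) -> e * e = e -> e * z = z -> z * e = z ->
  e * x + x * e = z *+ 2 -> e * x = z /\ x * e = z.
Proof.
move=> tf ee ez ze exz.
have l : e * x + e * x * e = z *+ 2.
  have := congr1 ( *%R e) exz.
  by rewrite mulrDr !mulrA ee mulrnAr ez.
have exe : e * x = x * e.
  have := congr1 ( *%R^~ e) exz.
  by rewrite mulrDl -(mulrA x) ee mulrnAl ze -l addrC => /addIr.
suff E : e * x = z by rewrite -exe.
by apply: tf; rewrite /= -exz -exe mulr2n.
Qed.

(** Compressing by [e1] or by [e2] on both sides kills the diagonal Peirce components of [x]; then
    [e1 x] and [x e2] both equal [e1 x e2]. *)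
Lemma peirce_half_swap (A : pzRingType) (e1 e2 x : A) :
    injective (fun a : A => a *+ 2) ->
    e1 * e1 = e1 -> e2 * e2 = e2 -> e1 * e2 = 0 -> e2 * e1 = 0 ->
  e1 * x + x * e1 = e2 * x + x * e2 -> e1 * x = x * e2.
Proof.
move=> tf e11 e22 e12 e21 ex.
have z1 : e1 * x * e1 = 0.
  apply: tf; have := congr1 (fun a => e1 * a * e1) ex.
  rewrite !mulrDr !mulrDl !mulrA e11 e12 -!mulrA e11 e21 !mulr0 !mul0r !addr0.
  by rewrite mulr2n mul0rn.
have z2 : e2 * x * e2 = 0.
  apply: tf; have := congr1 (fun a => e2 * a * e2) ex.
  rewrite !mulrDr !mulrDl !mulrA e22 e21 -!mulrA e22 e12 !mulr0 !mul0r !addr0.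
  by rewrite mulr2n mul0rn.
have := congr1 ( *%R e1) ex; have := congr1 ( *%R^~ e2) ex.
rewrite /= !mulrDr !mulrDl !mulrA e11 e12 -!mulrA e22 e12 !mulr0 !mul0r.
by rewrite !mulrA z1 z2 !addr0 !add0r => E ->.
Qed.

Lemma peirce_diag_swap (A : pzRingType) (e1 e2 x a1 a2 : A) :
    e1 * e2 = 0 -> e2 * e1 = 0 -> e1 * x = x * e2 ->
    e1 * a1 = a1 -> e2 * a2 = a2 ->
  a1 * x + x * a1 = a2 * x + x * a2 -> a1 * x = x * a2.
Proof.
move=> e12 e21 ex ea1 ea2 ax.
have z1 : e1 * a2 = 0 by rewrite -ea2 mulrA e12 mul0r.
have z2 : e2 * a1 = 0 by rewrite -ea1 mulrA e21 mul0r.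
have := congr1 ( *%R e1) ax; rewrite /= !mulrDr !mulrA ea1 ex z1.
by rewrite -!mulrA z2 ea2 mulr0 mul0r addr0 add0r.
Qed.

(** * Jordan multiplicative maps on two by two matrices *)

(* [f a b c d] stands for the image of the matrix [[a, b], [c, d]]. *)
Section TwoByTwo.

Variables (F : fieldType) (A : pzRingType) (f : F -> F -> F -> F -> A).
Hypotheses (two : 2%:R != 0 :> F) (tf : injective (fun a : A => a *+ 2)).
Hypothesis f0 : f 0 0 0 0 = 0.
(** The premises say entrywise that [X Y + Y X = 2 Z]; in this form each instance is left to [ring]
    or [field]. *)
Hypothesis fJ : forall a b c d a' b' c' d' x y z w : F,
  a * a' *+ 2 + (b * c' + b' * c) = x *+ 2 ->
  (a + d) * b' + (a' + d') * b = y *+ 2 ->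
  (a + d) * c' + (a' + d') * c = z *+ 2 ->
  d * d' *+ 2 + (b * c' + b' * c) = w *+ 2 ->
  f a b c d * f a' b' c' d' + f a' b' c' d' * f a b c d = f x y z w *+ 2.

Let e1 := f 1 0 0 0.
Let e2 := f 0 0 0 1.
Let u := f 1 0 0 1.
Let s := f 0 1 1 0.
Let x := f 0 1 0 0.
Let y := f 0 0 1 0.
Let p1 a := f a 0 0 0.
Let p2 a := f 0 0 0 a.
Let c a := f a 0 0 a.

Let e11 : e1 * e1 = e1.
Proof. by apply: tf; rewrite /= {1}mulr2n; apply: fJ; field. Qed.

Let e22 : e2 * e2 = e2.
Proof. by apply: tf; rewrite /= {1}mulr2n; apply: fJ; field. Qed.

Let uu : u * u = u.
Proof. by apply: tf; rewrite /= {1}mulr2n; apply: fJ; field. Qed.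

Let ss : s * s = u.
Proof. by apply: tf; rewrite /= {1}mulr2n; apply: fJ; field. Qed.

Let xx : x * x = 0.
Proof. by apply: tf; rewrite /= -f0 {1}mulr2n; apply: fJ; field. Qed.

Let yy : y * y = 0.
Proof. by apply: tf; rewrite /= -f0 {1}mulr2n; apply: fJ; field. Qed.

Let e120 : e1 * e2 = 0 /\ e2 * e1 = 0.
Proof.
apply: idem_jordan_corner => //; rewrite ?mulr0 ?mul0r // -f0.
by apply: fJ; field.
Qed.
Let e12 : e1 * e2 = 0. Proof. exact: e120.1. Qed.
Let e21 : e2 * e1 = 0. Proof. exact: e120.2. Qed.

Let uf a b c' d : u * f a b c' d = f a b c' d /\ f a b c' d * u = f a b c' d.
Proof. by apply: idem_jordan_fix => //; apply: fJ; ring. Qed.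

Let p1P a : e1 * p1 a = p1 a /\ p1 a * e1 = p1 a.
Proof. by apply: idem_jordan_fix => //; apply: fJ; ring. Qed.

Let p2P a : e2 * p2 a = p2 a /\ p2 a * e2 = p2 a.
Proof. by apply: idem_jordan_fix => //; apply: fJ; ring. Qed.

Let diag1 a d : e1 * f a 0 0 d = p1 a /\ f a 0 0 d * e1 = p1 a.
Proof.
by have [? ?] := p1P a; apply: idem_jordan_corner => //; apply: fJ; ring.
Qed.

Let diag2 a d : e2 * f a 0 0 d = p2 d /\ f a 0 0 d * e2 = p2 d.
Proof.
by have [? ?] := p2P d; apply: idem_jordan_corner => //; apply: fJ; ring.
Qed.

Let offdiag a b c' : p1 a * f 0 b c' 0 = f 0 b c' 0 * p2 a
  /\ p2 a * f 0 b c' 0 = f 0 b c' 0 * p1 a.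
Proof.
set z := f 0 b c' 0.
(* Both diag(a', 0) and diag(0, a') act on an off-diagonal matrix, under the Jordan product, as
   multiplication by a'/2. *)
have E a' : p1 a' * z + z * p1 a' = p2 a' * z + z * p2 a'.
  pose g := f 0 (a' * b / 2%:R) (a' * c' / 2%:R) 0.
  by transitivity (g *+ 2); [|symmetry]; apply: fJ; field.
have h1 : e1 * z = z * e2 by exact/peirce_half_swap/(E 1).
have h2 : e2 * z = z * e1 by exact/peirce_half_swap/esym/(E 1).
have [[q1 _] [q2 _]] := (p1P a, p2P a).
split; first exact: (peirce_diag_swap _ _ h1).
by apply: (peirce_diag_swap _ _ h2).
Qed.

Let e1s : e1 * s = s * e2. Proof. exact: (offdiag 1 1 1).1. Qed.
Let e2s : e2 * s = s * e1. Proof. exact: (offdiag 1 1 1).2. Qed.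

(* With q the image of 1/4, 4 q = e1 + e2; as q is inverted by the image of 4,
   e1 + e2 has to be the whole unit. *)
Lemma corner_unit : u = e1 + e2.
Proof.
pose q := f 4%:R^-1 0 0 4%:R^-1; pose s' := f 0 2%:R^-1 2%:R^-1 0.
have four : 4%:R != 0 :> F by rewrite (natrM _ 2 2) mulf_neq0.
have gg : (e1 + e2) * (e1 + e2) = e1 + e2.
  by rewrite mulrDl !mulrDr e11 e12 e21 e22 addr0 add0r.
have gs : (e1 + e2) * s = s * (e1 + e2).
  by rewrite mulrDl mulrDr e1s e2s addrC.
have Es' : s' *+ 2 = (e1 + e2) * s.
  by rewrite mulrDl e2s; apply/esym/fJ; field.
(* [s'] squares to [q], while its double [(e1 + e2) * s] squares to [e1 + e2]. This computes a
   multiple of [q] before any additivity of [f] is known. *)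
have Eq : q *+ 4 = e1 + e2.
  have -> : q *+ 4 = (s' *+ 2) * (s' *+ 2).
    rewrite mulrnAr mulrnAl (mulrnA q 2 2); congr (_ *+ 2).
    by rewrite [RHS]mulr2n; apply/esym/fJ; field; rewrite ?four.
  rewrite Es' {1}gs -mulrA (mulrA _ _ s) gg gs mulrA ss mulrDr.
  by rewrite !(uf _ _ _ _).1.
pose z := c 4%:R.
have Ez : q * z + z * q = u *+ 2 by apply: fJ; field.
have [[z1 z1'] [z2 z2']] := (diag1 4%:R 4%:R, diag2 4%:R 4%:R).
have Eu : (e1 + e2) * z = u *+ 4.
  apply: tf; rewrite /= [RHS]mulrnAC -Ez mulrnDl -(mulrnAl q) -(mulrnAr z).
  by rewrite Eq mulrDr mulrDl z1 z1' z2 z2' mulr2n.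
have gu : (e1 + e2) * u = e1 + e2 by rewrite mulrDl !(uf _ _ _ _).2.
(* Multiplication by [e1 + e2] fixes the left side of [Eu], so [4 (e1 + e2) = 4 u]. *)
rewrite -gu; apply/tf/tf; rewrite /= -!mulrnA -mulrnAr -Eu.
by rewrite mulrA gg.
Qed.

Let diagE a d : f a 0 0 d = p1 a + p2 d.
Proof.
by rewrite -(uf _ _ _ _).1 corner_unit mulrDl (diag1 _ _).1 (diag2 _ _).1.
Qed.

(* diag(a, b) o s depends on a + b only, and s is invertible. *)
Let cD a b : c (a + b) = c a + c b.
Proof.
suff E : c (a + b) * s = (c a + c b) * s.
  have := congr1 ( *%R^~ s) E.
  by rewrite /= -!mulrA ss mulrDl !(uf _ _ _ _).2.
pose g := f 0 ((a + b) / 2%:R) ((a + b) / 2%:R) 0.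
transitivity (g *+ 2).
  rewrite [c _]diagE mulrDl (offdiag _ _ _).2.
  by apply: fJ; field.
have <- : f a 0 0 b * s + s * f a 0 0 b = g *+ 2 by apply: fJ; field.
rewrite /c !diagE !mulrDl mulrDr -!(offdiag _ _ _).1 -!(offdiag _ _ _).2.
by rewrite addrACA (addrC (p2 b * s)).
Qed.

Let c_offdiagC a b c' : c a * f 0 b c' 0 = f 0 b c' 0 * c a.
Proof.
by rewrite /c diagE mulrDl mulrDr (offdiag _ _ _).1 (offdiag _ _ _).2 addrC.
Qed.

Let cx a : f 0 a 0 0 = c a * x.
Proof.
apply: tf; rewrite /= [RHS]mulr2n [X in _ = _ + X]c_offdiagC.
by apply/esym/fJ; ring.
Qed.

Let cy a : f 0 0 a 0 = c a * y.
Proof.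
apply: tf; rewrite /= [RHS]mulr2n [X in _ = _ + X]c_offdiagC.
by apply/esym/fJ; ring.
Qed.

(** The Jordan product of a E_12 and b E_21 is the scalar matrix ab/2; [cD] absorbs the factor 2. *)
Let cM_twisted a b : c a * c b * (x * y) + c b * c a * (y * x) = c (a * b).
Proof.
have -> : c (a * b) = c (a * b / 2%:R) *+ 2.
  by rewrite mulr2n -cD; congr c; field.
transitivity (f 0 a 0 0 * f 0 0 b 0 + f 0 0 b 0 * f 0 a 0 0).
  rewrite cx cy !mulrA -(mulrA (c a) x) -(c_offdiagC b) -(mulrA (c b) y).
  by rewrite -(c_offdiagC a) !mulrA.
by apply: fJ; field.
Qed.

Let xyu : x * y + y * x = u.
Proof.
have := cM_twisted 1 1; rewrite mulr1 [c 1 * _]uu -mulrDr mulrDr !mulrA.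
by rewrite !(uf _ _ _ _).1.
Qed.

(* Exchanging a and b in [cM_twisted] shows that the commutator of [c a] and
   [c b] takes the same values on the orthogonal idempotents xy and yx. *)
Let cM a b : c (a * b) = c a * c b.
Proof.
suff cC : c a * c b = c b * c a.
  by rewrite -cM_twisted -cC -mulrDr xyu -mulrA (uf _ _ _ _).2.
pose C := c a * c b - c b * c a.
have CE : C * (x * y) = C * (y * x).
  apply/eqP; rewrite !mulrBl subr_eq addrAC -subr_eq opprK.
  by rewrite cM_twisted addrC cM_twisted mulrC.
have Cxy : C * (x * y) = 0.
  (* Since [y y = 0], the unit [xy + yx] gives [y = yxy]. *)
  have E : x * y * (x * y) = x * y.
    have yE : u * y = y := (uf 0 0 1 0).1.
    by rewrite -mulrA (mulrA y) -{3}yE -xyu mulrDl -(mulrA x) yy mulr0 add0r.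
  by rewrite -E mulrA CE -!mulrA (mulrA x x) xx mul0r !mulr0.
apply/eqP; rewrite -subr_eq0 -/C -(_ : C * u = C); last first.
  by rewrite mulrBl -!mulrA !(uf _ _ _ _).2.
by rewrite -xyu mulrDr -CE Cxy addr0.
Qed.

(** [p1] is the morphism [c] cut down by [e1], which commutes with it. The witness [t] is [s]; it
    serves to compare ranks. *)
Lemma two_by_two_morphism :
  [/\ {morph p1 : a b / a + b >-> a + b}, {morph p1 : a b / a * b >-> a * b},
      e1 * e1 = e1, e1 * e2 = 0 & exists t, t * e2 * t = e1].
Proof.
have p1E a : p1 a = e1 * c a by rewrite (diag1 a a).1.
split=> //.
- by move=> a b; rewrite !p1E -mulrDr cD.
- move=> a b; rewrite p1E cM mulrA -p1E -(p1P a).2 -mulrA -p1E.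
  by rewrite (p1P a).2.
- by exists s; rewrite -e1s -mulrA ss (uf _ _ _ _).2.
Qed.

End TwoByTwo.

(** * Matrix corners, ranks of idempotents and compression *)

Lemma pchar_neq2 (L : fieldType) : 2%N \notin [pchar L] -> 2%:R != 0 :> L.
Proof. by rewrite inE. Qed.

Lemma mx_mulr2n_inj (L : fieldType) (m p : nat) :
  2%:R != 0 :> L -> injective (fun X : 'M[L]_(m, p) => X *+ 2).
Proof. by move=> two X Y; rewrite /= -!scaler_nat => /(scalerI two). Qed.

Lemma jordan_mulP (L : fieldType) (m : nat) (X Y Z : 'M[L]_m) :
  2%:R != 0 :> L -> jordan_mul X Y = Z <-> X * Y + Y * X = Z *+ 2.
Proof.
move=> two; rewrite /jordan_mul -scaler_nat; split=> [<- | ->].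
  by rewrite scalerA divff // scale1r.
by rewrite scalerA mulVf // scale1r.
Qed.

Section Corner.

Variables (F : fieldType) (n : nat) (i j : 'I_n).

Definition corner_mx (a b c d : F) : 'M[F]_n :=
  a *: delta_mx i i + b *: delta_mx i j + c *: delta_mx j i + d *: delta_mx j j.

Lemma corner_mxD a b c d a' b' c' d' :
  corner_mx a b c d + corner_mx a' b' c' d'
  = corner_mx (a + a') (b + b') (c + c') (d + d').
Proof.
rewrite /corner_mx !scalerDl; apply/matrixP=> p q; rewrite !mxE; ring.
Qed.

Lemma corner_mxM a b c d a' b' c' d' : i != j ->
  corner_mx a b c d *m corner_mx a' b' c' d'
  = corner_mx (a * a' + b * c') (a * b' + b * d')
              (c * a' + d * c') (c * b' + d * d').
Proof.
move=> ij; have ji : j != i by rewrite eq_sym.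
rewrite /corner_mx !mulmxDl !mulmxDr -!scalemxAl -!scalemxAr !scalerA.
rewrite !mul_delta_mx !mul_delta_mx_0 // !scaler0.
by apply/matrixP=> p q; rewrite !mxE; ring.
Qed.

End Corner.

Lemma orth_idem_rank (L : fieldType) (n k r : nat) (e : 'I_n -> 'M[L]_k) :
    (forall i, e i * e i = e i) -> (forall i j, i != j -> e i * e j = 0) ->
    (forall i, \rank (e i) = r) ->
  (n * r <= k)%N.
Proof.
move=> ee eo er.
have dx : mxdirect (\sum_i e i).
  apply/mxdirect_sumsP=> i _; set S := (\sum_(l | _) _)%MS.
  apply/eqP; rewrite -submx0; set W := (_ :&: _)%MS.
  have /submxP[D WD] : (W <= e i)%MS by rewrite capmxSl.
  (* The intersection [W] is fixed by [e i], yet killed by it because it lies in the sum of the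
     other row spaces. *)
  have -> : W = W *m e i by rewrite {2}WD -mulmxA [e i *m e i]ee -WD.
  have WS : (W <= S)%MS by rewrite capmxSr.
  rewrite (submx_trans (submxMr (e i) WS)) // sumsmxMr_gen.
  apply/sumsmx_subP=> l /= li; rewrite genmxE (_ : _ *m _ = 0) ?sub0mx //.
  exact: eo.
have := rank_leq_col (\sum_i e i)%MS; rewrite (mxdirectP dx) /=.
by rewrite (eq_bigr (fun=> r)) // sum_nat_const card_ord.
Qed.

(** A full-rank factorization [e = U V] of an idempotent has [V U = 1], so [V (p a) U] is the
    compression of [p] to the range of [e] and is unital. *)
Lemma idem_corner_rmorphism (F L : fieldType) (k : nat) (p : F -> 'M[L]_k)
    (e : 'M[L]_k) :
    {morph p : a b / a + b} -> {morph p : a b / a * b} -> p 1 = e ->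
  inhabited {rmorphism F -> 'M[L]_(\rank e)}.
Proof.
move=> pD pM p1.
have ee : e *m e = e by rewrite -p1 mulmxE -pM mulr1.
have [U [V [UV VU]]] : exists (U : 'M_(k, \rank e)) (V : 'M_(\rank e, k)),
    U *m V = e /\ V *m U = 1%:M.
  exists (col_base e), (row_base e); split; first exact: mulmx_base.
  apply/(row_full_inj (col_base_full e))/(row_free_inj (row_base_free e)).
  by rewrite mulmx1 (mulmxA (col_base e)) mulmx_base -mulmxA mulmx_base ee.
(* Generalizing the rank lets [e] be rewritten as [U *m V] without touching dimensions. *)
move: (\rank e) U V UV VU => r U V UV VU.
pose g a := V *m p a *m U.
have gB : zmod_morphism g.
  have p0 : p 0 = 0 by apply: (addrI (p 0)); rewrite -pD !addr0.
  move=> a b; rewrite /g -mulmxBl -mulmxBr; congr (_ *m _ *m _).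
  by apply/eqP; rewrite eq_sym subr_eq -pD subrK.
have gM : monoid_morphism g.
  split=> [|a b].
    by rewrite /g p1 -UV mulmxA VU mul1mx VU.
  rewrite /g; have -> : p (a * b) = p a *m e *m p b.
    by rewrite -p1 !mulmxE -!pM mulr1.
  by rewrite -UV -mulmxE !mulmxA.
pose zm := GRing.isZmodMorphism.Build _ _ g gB.
pose mm := GRing.isMonoidMorphism.Build _ _ g gM.
pose h : {rmorphism F -> 'M[L]_r} := HB.pack g zm mm.
by constructor.
Qed.

(** * From a nonconstant Jordan multiplicative map to a field morphism *)

Section Forward.

Variables (F K : fieldType) (n k : nat) (psi : 'M[F]_n -> 'M[K]_k).
Hypotheses (twoF : 2%:R != 0 :> F) (twoK : 2%:R != 0 :> K).
Hypothesis psi0 : psi 0 = 0.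
Hypothesis psiJ : forall X Y Z : 'M[F]_n, X * Y + Y * X = Z *+ 2 ->
  psi X * psi Y + psi Y * psi X = psi Z *+ 2.

Let E i : 'M[F]_n := delta_mx i i.

Lemma jordan_corner_morphism (i j : 'I_n) : i != j ->
  [/\ {morph (fun a => psi (a *: E i)) : a b / a + b},
      {morph (fun a => psi (a *: E i)) : a b / a * b},
      psi (E i) * psi (E i) = psi (E i), psi (E i) * psi (E j) = 0
    & (\rank (psi (E i)) <= \rank (psi (E j)))%N].
Proof.
move=> ij; pose f a b c d := psi (corner_mx i j a b c d).
have fi a : f a 0 0 0 = psi (a *: E i).
  by rewrite /f /corner_mx !scale0r !addr0.
have fj a : f 0 0 0 a = psi (a *: E j).
  by rewrite /f /corner_mx !scale0r !add0r.
have [] := @two_by_two_morphism F _ f twoF (mx_mulr2n_inj twoK).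
- by rewrite fi scale0r.
- move=> a b c d a' b' c' d' x y z w hx hy hz hw; apply: psiJ.
  rewrite -!mulmxE !corner_mxM // corner_mxD mulr2n corner_mxD.
  by rewrite -!mulr2n -hx -hy -hz -hw; congr corner_mx; ring.
rewrite !fi fj !scale1r => pD pM ee eo [t te].
split=> //.
- by move=> a b; rewrite -!fi pD.
- by move=> a b; rewrite -!fi pM.
- by rewrite -te (leq_trans (mxrankM_maxl _ _)) // mxrankM_maxr.
Qed.

Lemma jordan_ker_mul X Y Z : psi X = 0 -> X * Y + Y * X = Z *+ 2 -> psi Z = 0.
Proof.
move=> X0 /psiJ; rewrite X0 mul0r mulr0 addr0 => Z0.
by apply: (mx_mulr2n_inj twoK); rewrite /= -Z0 mul0rn.
Qed.

(* The kernel absorbs Jordan products, and it collects the E_jj one by one: if D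
   is a diagonal idempotent of the kernel above E_ii and orthogonal to E_jj, then
   S = D - E_ii + E_ij + E_ji is a Jordan multiple of D, and S ^+ 2 = D + E_jj. *)
Lemma jordan_ker_delta (i : 'I_n) : psi (E i) = 0 -> forall X, psi X = 0.
Proof.
move=> Ei0 X.
have stepD (D : 'M[F]_n) (j : 'I_n) : j != i -> psi D = 0 -> D * D = D ->
    D *m E i = E i -> E i *m D = E i ->
    D *m E j = 0 -> E j *m D = 0 -> psi (D + E j) = 0.
  move=> ji D0 DD DEi EiD DEj EjD.
  have ij : i != j by rewrite eq_sym.
  pose T : 'M[F]_n := delta_mx i j + delta_mx j i.
  have dl (p q : 'I_n) : E p *m delta_mx p q = delta_mx p q.
    by rewrite mul_delta_mx.
  have dr (p q : 'I_n) : delta_mx p q *m E q = delta_mx p q.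
    by rewrite mul_delta_mx.
  have DT : D *m T = delta_mx i j.
    by rewrite mulmxDr -(dl i j) -(dl j i) !mulmxA DEi DEj mul0mx addr0.
  have TD : T *m D = delta_mx j i.
    by rewrite mulmxDl -(dr i j) -(dr j i) -!mulmxA EiD EjD mulmx0 add0r.
  pose S := D - E i + T.
  have S0 : psi S = 0.
    (* The Jordan product with [D] fixes [D - E i] and halves [T], hence the doubled [T]. *)
    apply: (jordan_ker_mul (Y := D - E i + T *+ 2) D0).
    rewrite -mulmxE mulr2n mulmxDr mulmxDl mulmxBr mulmxBl.
    rewrite [D *m D]DD DEi EiD mulmxDr mulmxDl DT TD.
    by apply/matrixP=> p q; rewrite !mxE; ring.
  apply: (jordan_ker_mul (Y := S) S0); rewrite -mulr2n; congr (_ *+ 2).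
  have DS : D *m S = D - E i + delta_mx i j.
    by rewrite mulmxDr mulmxBr DT DEi [D *m D]DD.
  have ES : E i *m S = delta_mx i j.
    rewrite mulmxDr mulmxBr EiD mul_delta_mx subrr add0r mulmxDr.
    by rewrite mul_delta_mx mul_delta_mx_0 ?addr0.
  have TS : T *m S = E i + E j.
    rewrite mulmxDr mulmxBr TD mulmxDl mul_delta_mx mul_delta_mx_0 ?add0r //.
    rewrite subrr add0r mulmxDr !mulmxDl !mul_delta_mx !mul_delta_mx_0 //.
    by rewrite addr0 add0r addrC.
  by rewrite -mulmxE {1}/S mulmxDl mulmxBl DS ES TS addrK addrA subrK.
pose D (A : {set 'I_n}) : 'M[F]_n := \sum_(l in A) E l.
have DE (A : {set 'I_n}) j : D A *m E j = if j \in A then E j else 0.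
  rewrite mulmx_suml; case: ifP => jA.
    rewrite (bigD1 j) //= mul_delta_mx big1 ?addr0 // => l /andP[_ lj].
    by rewrite mul_delta_mx_0.
  rewrite big1 // => l lA; rewrite mul_delta_mx_0 //.
  by apply: contraFN jA => /eqP <-.
have ED (A : {set 'I_n}) j : E j *m D A = if j \in A then E j else 0.
  rewrite mulmx_sumr; case: ifP => jA.
    rewrite (bigD1 j) //= mul_delta_mx big1 ?addr0 // => l /andP[_ lj].
    by rewrite mul_delta_mx_0 // eq_sym.
  rewrite big1 // => l lA; rewrite mul_delta_mx_0 //.
  by apply: contraFN jA => /eqP ->.
have DD (A : {set 'I_n}) : D A * D A = D A.
  by rewrite -mulmxE {2}/D mulmx_sumr; apply: eq_bigr => l lA; rewrite DE lA.
(* Once all indices are listed, the identity lies in the kernel, and with it every matrix. *)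
have D0 (s : seq 'I_n) : psi (D (i |: [set:: s])) = 0.
  elim: s => [|j s IH]; first by rewrite set_nil setU0 /D big_set1.
  rewrite set_cons setUCA; set A := i |: _ in IH *.
  have [jA|jA] := boolP (j \in A); first by rewrite (setUidPr _) ?sub1set.
  have -> : D (j |: A) = D A + E j by rewrite addrC /D big_setU1.
  have iA : i \in A by rewrite setU11.
  have ji : j != i by apply: contraNneq jA => ->.
  by apply: stepD; rewrite ?DE ?ED ?iA ?(negPf jA).
have DT : D [set: 'I_n] = 1%:M.
  by rewrite mx1_sum_delta; apply: eq_bigl => l; rewrite inE.
have := D0 (enum 'I_n); rewrite (_ : _ |: _ = [set: 'I_n]) ?DT; last first.
  by apply/setP=> l; rewrite !inE mem_enum orbT.
move=> one0; apply: (jordan_ker_mul (Y := X) one0).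
by rewrite -mulmxE mul1mx mulmx1 mulr2n.
Qed.

Lemma jordan_embeddable : (2 <= n)%N -> (exists X, psi X <> 0) ->
  exists2 r, matrix_embeddable K F r & (n * r <= k)%N.
Proof.
move=> n2 [X X0].
pose i : 'I_n := Ordinal (ltnW n2); pose j : 'I_n := Ordinal n2.
exists (\rank (psi (E i))).
  have [//|pD pM _ _ _] := @jordan_corner_morphism i j; split.
    rewrite lt0n mxrank_eq0; apply/eqP => Ei0.
    exact/X0/(jordan_ker_delta Ei0).
  by apply: (idem_corner_rmorphism pD pM); rewrite scale1r.
apply: (@orth_idem_rank K n k _ (fun l => psi (E l))) => [l|l m|l].
- have [<-|il] := eqVneq i l.
    by have [//|_ _ ->] := @jordan_corner_morphism i j.
  by have [|_ _ ->] := @jordan_corner_morphism l i; rewrite // eq_sym.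
- by move=> /jordan_corner_morphism[].
- have [->//|il] := eqVneq i l; apply/eqP; rewrite eqn_leq.
  have [_ _ _ _ ->] := jordan_corner_morphism il; rewrite andbT.
  by rewrite eq_sym in il; have [_ _ _ _ ->] := jordan_corner_morphism il.
Qed.

End Forward.

(** As 0 absorbs Jordan products, [P = phi 0] is idempotent and [P (phi Y) = (phi Y) P = P]. Hence
    [phi - P] is again Jordan multiplicative and vanishes at 0. *)
Lemma jordan_nonconstant_embeddable (F K : fieldType) (n k : nat)
    (phi : 'M[F]_n -> 'M[K]_k) :
    2%:R != 0 :> F -> 2%:R != 0 :> K -> (2 <= n)%N ->
    jordan_multiplicative phi -> (exists X, phi X <> phi 0) ->
  exists2 r, matrix_embeddable K F r & (n * r <= k)%N.
Proof.
move=> twoF twoK n2 phiJ [X X0].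
have tf := @mx_mulr2n_inj K k k twoK.
have phiJ' (A B C : 'M[F]_n) : A * B + B * A = C *+ 2 ->
    phi A * phi B + phi B * phi A = phi C *+ 2.
  by move=> /jordan_mulP-/(_ twoF) <-; apply/jordan_mulP.
have PP : phi 0 * phi 0 = phi 0.
  by apply: tf; rewrite /= {1}mulr2n; apply: phiJ'; rewrite mulr0 addr0 mul0rn.
have PX Y : phi 0 * phi Y = phi 0 /\ phi Y * phi 0 = phi 0.
  apply: idem_jordan_corner => //.
  by apply: phiJ'; rewrite mulr0 mul0r addr0 mul0rn.
apply: (@jordan_embeddable F K n k (fun Y => phi Y - phi 0)) => //.
- by rewrite subrr.
- move=> A B C /phiJ' ABC.
  rewrite !mulrBl !mulrBr !(PX _).1 !(PX _).2 subrr !subr0 mulrnBl -ABC.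
  by rewrite addrACA -opprD mulr2n.
- by exists X => /eqP; rewrite subr_eq0 => /eqP.
Qed.

(** * Entrywise block embedding along a field morphism *)

Section Converse.

Variables (F K : fieldType) (n k r : nat) (rho : {rmorphism F -> 'M[K]_r}).
Hypothesis nrk : (n * r <= k)%N.

(** Selects the [i]-th block of [r] consecutive coordinates; the last [k - n r] coordinates lie in
    no block and provide the zero padding. *)
Let V (i : 'I_n) : 'M[K]_(r, k) :=
  \matrix_(a, b) ((b == i * r + a :> nat)%N)%:R.

Let VV i j : V i *m (V j)^T = (i == j)%:R%:M.
Proof.
apply/matrixP=> a b; rewrite !mxE.
have lt : (i * r + a < k)%N.
  apply: leq_trans nrk; apply: (@leq_trans (i.+1 * r)%N).
    by rewrite mulSn addnC ltn_add2r.
  by rewrite leq_mul2r ltn_ord orbT.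
rewrite (bigD1 (Ordinal lt)) //= !mxE eqxx mul1r big1 => [|c cE].
  rewrite addr0 -mulrnA mulnb; congr (_%:R); congr nat_of_bool.
  rewrite /=; apply/eqP/andP=> [e|[/eqP-> /eqP->]//].
  have r0 : (0 < r)%N := leq_ltn_trans (leq0n a) (ltn_ord a).
  (* Euclidean division by [r] recovers the block and the position inside it. *)
  have := congr1 (divn^~ r) e; have := congr1 (modn^~ r) e.
  rewrite !modnMDl !divnMDl // !modn_small // !divn_small // !addn0.
  by move=> ab ij; split; apply/eqP/val_inj.
rewrite !mxE (_ : (c == _ :> nat) = false) ?mul0r //.
by apply: contraNF cE => /eqP cE; apply/eqP/val_inj.
Qed.

Definition block_embed (X : 'M[F]_n) : 'M[K]_k :=
  \sum_i \sum_j (V i)^T *m rho (X i j) *m V j.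

Lemma block_embedD X Y : block_embed (X + Y) = block_embed X + block_embed Y.
Proof.
rewrite -big_split; apply: eq_bigr => i _ /=.
rewrite -big_split; apply: eq_bigr => j _ /=.
by rewrite mxE rmorphD mulmxDr mulmxDl.
Qed.

(** By [VV] only one term of the double sum survives; this separates the images of 1 and 0. *)
Lemma block_embed_corner X i j : V i *m block_embed X *m (V j)^T = rho (X i j).
Proof.
rewrite /block_embed mulmx_sumr mulmx_suml (bigD1 i) //=.
rewrite [X in _ + X]big1 => [|l li]; last first.
  rewrite mulmx_sumr mulmx_suml big1 // => m _.
  by rewrite !mulmxA VV eq_sym (negPf li) raddf0 !mul0mx.
rewrite mulmx_sumr mulmx_suml (bigD1 j) //= big1 => [|l lj]; last first.
  by rewrite -!mulmxA VV (negPf lj) raddf0 !mulmx0.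
by rewrite !addr0 !mulmxA VV eqxx mul1mx -mulmxA VV eqxx mulmx1.
Qed.

Lemma block_embedM X Y : block_embed (X *m Y) = block_embed X *m block_embed Y.
Proof.
rewrite {2}/block_embed mulmx_suml; apply: eq_bigr => i _; rewrite mulmx_suml.
under eq_bigr do rewrite mxE rmorph_sum mulmx_sumr mulmx_suml.
rewrite exchange_big; apply: eq_bigr => l _ /=.
rewrite /block_embed mulmx_sumr [RHS](bigD1 l) //=.
rewrite [X in _ = _ + X]big1 ?addr0 => [|m ml].
  rewrite mulmx_sumr; apply: eq_bigr => j _.
  by rewrite rmorphM -mulmxE !mulmxA -(mulmxA _ (V l)) VV eqxx mulmx1.
rewrite mulmx_sumr big1 // => j _.
by rewrite !mulmxA -(mulmxA _ (V l)) VV eq_sym (negPf ml) raddf0 mulmx0 !mul0mx.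
Qed.

Lemma block_embed_nonconstant : (0 < n)%N -> (0 < r)%N ->
  nonconstant block_embed.
Proof.
move=> n0 r0; exists 1%:M, 0 => e.
pose i : 'I_n := Ordinal n0; pose a : 'I_r := Ordinal r0.
have := block_embed_corner 1%:M i i.
rewrite e block_embed_corner !mxE eqxx rmorph0 rmorph1.
move=> /matrixP/(_ a a)/eqP; rewrite !mxE eqxx eq_sym oner_eq0 //.
Qed.

Lemma block_embedJ : 2%:R != 0 :> F -> 2%:R != 0 :> K ->
  jordan_multiplicative block_embed.
Proof.
move=> twoF twoK X Y; apply/esym/jordan_mulP => //.
rewrite -!mulmxE -!block_embedM -block_embedD mulr2n -block_embedD -mulr2n.
by congr block_embed; apply/jordan_mulP.
Qed.

End Converse.

(** * Comparison with the degree *)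

Theorem corollary4p3 (F K : fieldType) (n k : nat)
    (charF : 2%N \notin [pchar F]) (charK : 2%N \notin [pchar K])
    (n_ge2 : (2 <= n)%N) (k_ge1 : (1 <= k)%N) :
  ((exists phi : 'M[F]_n -> 'M[K]_k,
      jordan_multiplicative phi /\ nonconstant phi)
   <-> muln_ext_leq n (matrix_degree K F) k)
  /\
  (ltn_muln_ext k n (matrix_degree K F) ->
   forall phi : 'M[F]_n -> 'M[K]_k, jordan_multiplicative phi ->
   exists E : 'M[K]_k, E *m E = E /\ (forall X, phi X = E)).
Proof.
have [twoF twoK] := (pchar_neq2 charF, pchar_neq2 charK).
have fwd (phi : 'M[F]_n -> 'M[K]_k) : jordan_multiplicative phi ->
    (exists X, phi X <> phi 0) -> muln_ext_leq n (matrix_degree K F) k.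
  move=> phiJ nc.
  have [r rE nrk] := jordan_nonconstant_embeddable twoF twoK n_ge2 phiJ nc.
  case E: (matrix_degree K F) => [d|] /=; last first.
    by move/matrix_degree_NoneP: E => /(_ r).
  have [_ /(_ r rE) dr] := (matrix_degree_SomeP K F d).1 E.
  by rewrite (leq_trans _ nrk) // leq_mul2l dr orbT.
split; first split.
- move=> [phi [phiJ [X [Y XY]]]]; apply: (fwd phi phiJ).
  (* Of two distinct values, at least one differs from [phi 0]. *)
  have [eX|neX] := eqVneq (phi X) (phi 0); last by exists X; apply/eqP.
  by exists Y => eY; apply: XY; rewrite eX eY.
- case E: (matrix_degree K F) => [d|] //= ndk.
  have [[d0 [rho]] _] := (matrix_degree_SomeP K F d).1 E.
  exists (block_embed k rho); split; first exact: block_embedJ.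
  by apply: block_embed_nonconstant => //; apply: ltnW.
- move=> lt phi phiJ; exists (phi 0); split.
    have /jordan_mulP-/(_ twoK) := esym (phiJ 0 0).
    rewrite (_ : jordan_mul 0 0 = 0); last first.
      by rewrite /jordan_mul mul0mx addr0 scaler0.
    by rewrite -mulr2n => /(mx_mulr2n_inj twoK).
  move=> X; apply/eqP; apply: contraTT lt => /eqP nX.
  have := fwd phi phiJ (ex_intro _ X nX).
  by case: (matrix_degree K F) => //= d; rewrite -leqNgt.
Qed.
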